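(* Let $\mathbb{K}\in\{\mathbb{R},\mathbb{C}\}$, let $(\Omega,\Sigma,\mu)$ be a positive measure space, and let $\bm{\varphi}:\Omega\to\mathbb{K}^n$ be a $\mu$-frame for $\mathbb{K}^n$ with (lower and upper) frame bounds $A$, $B$. Then there exist $N\le\dim_{\mathbb{K}}\operatorname{lin}_{\mathbb{K}}\{\bm{\varphi}(x)\bm{\varphi}(x)^\ast: x\in\Omega\}$, points $x_1,\ldots,x_N\in\Omega$ and weights $s_1,\ldots,s_N>0$ such that $\{s_j\bm{\varphi}(x_j)\}_{j=1}^N$ is a discrete frame for $\mathbb{K}^n$ with the same frame bounds.
   Context: $\bm{v}^\ast=\overline{\bm{v}}^\top$ and $\operatorname{lin}_{\mathbb{K}}$ is the $\mathbb{K}$-linear span. A measurable function $\bm{\varphi}:\Omega\to\mathbb{K}^n$ is a $\mu$-frame for $\mathbb{K}^n$ if there are constants $0<A\le B<\infty$ with $$A\|f\|^2\le\int_\Omega|\langle f,\bm{\varphi}(x)\rangle|^2\,\mathrm{d}\mu(x)\le B\|f\|^2\quad\text{for all } f\in\mathbb{K}^n.$$ The largest such $A$ and the smallest such $B$ are called the lower and upper frame bound. A finite family $\{\bm{v}_j\}_{j=1}^N$ in $\mathbb{K}^n$ is a discrete frame if the analogous inequalities hold with $\sum_{j=1}^N|\langle f,\bm{v}_j\rangle|^2$ in place of the integral, with frame bounds defined accordingly. A positive measure takes values in $[0,\infty]$. *)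

(* Defs.v *)
From HB Require Import structures.
From mathcomp Require Import all_boot all_order all_algebra.
From mathcomp Require Import complex.
From mathcomp Require Import all_classical all_reals all_analysis.

Set Implicit Arguments.
Unset Strict Implicit.
Unset Printing Implicit Defensive.

Import Order.TTheory GRing.Theory Num.Theory.
Import numFieldNormedType.Exports.

Local Open Scope classical_set_scope.
Local Open Scope ring_scope.

Variant scalar_kind := RealScalars | ComplexScalars.

Section Scalars.
Variable R : realType.

Definition scalar_field (k : scalar_kind) : numFieldType :=
  match k with
  | RealScalars => R
  | ComplexScalars => R[i]%C
  end.

Definition of_real (k : scalar_kind) : R -> scalar_field k :=
  match k with
  | RealScalars => fun x => x
  | ComplexScalars => fun x => (x%:C)%C
  end.

Definition sconj (k : scalar_kind) : scalar_field k -> scalar_field k :=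
  match k with
  | RealScalars => fun x => x
  | ComplexScalars => fun x => conjc x
  end.

(* On a [numFieldType] the library norm is valued in the field itself; here the
   modulus is valued in [R] for both kinds of scalars. *)
Definition modulus (k : scalar_kind) : scalar_field k -> R :=
  match k with
  | RealScalars => fun x => `|x|
  | ComplexScalars => fun x => ComplexField.Normc.normc x
  end.

End Scalars.

Section LinearSpan.
Variables (K : fieldType) (vT : vectType K).
Implicit Types (S : set vT) (V : {vspace vT}).

Definition is_lin_span S V :=
  forall v, v \in V <->
    exists2 s : seq vT, (forall w, w \in s -> S w) & v \in span s.

(* [S] may be infinite, so its span is not a library [span] of a sequence;
   [lin_spanP] shows that the default value [0%VS] is never used. *)
Definition lin_span S : {vspace vT} := xget 0%VS [set V | is_lin_span S V].

Lemma is_lin_span_ex S : exists V, is_lin_span S V.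
Proof.
pose P m := `[< exists2 s : seq vT, (forall w, w \in s -> S w) &
                  \dim (span s) = m >].
have exP : exists m, P m.
  by exists (\dim (span ([::] : seq vT))); apply/asboolP; exists [::].
have ubP m : P m -> (m <= \dim {:vT})%N.
  by move=> /asboolP[s _ <-]; exact: dimvS (subvf _).
case: (ex_maxnP exP ubP) => m /asboolP[s sS ds] mmax.
exists (span s) => v; split=> [vs|[t tS vt]]; first by exists s.
have catS w : w \in s ++ t -> S w by rewrite mem_cat => /orP[/sS|/tS].
have dle : (\dim (span (s ++ t)) <= \dim (span s))%N.
  by rewrite ds; apply: mmax; apply/asboolP; exists (s ++ t).
have sub : (span s <= span (s ++ t))%VS by rewrite span_cat addvSl.
have /eqP -> : span s == span (s ++ t) by rewrite eqEdim sub.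
by rewrite span_cat (subvP (addvSr _ _)).
Qed.

Lemma lin_spanP S : is_lin_span S (lin_span S).
Proof.
by have [V SV] := is_lin_span_ex S; exact: (xgetPex 0%VS (ex_intro _ V SV)).
Qed.

End LinearSpan.

Section Frames.
Variables (R : realType) (k : scalar_kind) (n : nat).
Local Notation K := (scalar_field R k).

Definition adjoint m p (M : 'M[K]_(m, p)) : 'M[K]_(p, m) :=
  (map_mx (@sconj R k) M)^T.

Definition inner (f g : 'cV[K]_n) : K := \sum_(i < n) f i 0 * sconj (g i 0).

Definition sqnorm (f : 'cV[K]_n) : R := \sum_(i < n) modulus (f i 0) ^+ 2.

(* [Q f] stands for the frame energy of [f]: the integral, resp. the sum, of the
   squared moduli of the frame coefficients. *)
Definition frame_constants (Q : 'cV[K]_n -> \bar R) (A B : R) : Prop :=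
  0 < A /\ A <= B /\
  forall f, ((A * sqnorm f)%:E <= Q f)%E /\ (Q f <= (B * sqnorm f)%:E)%E.

Definition lower_frame_bound (Q : 'cV[K]_n -> \bar R) (A : R) : Prop :=
  (exists B, frame_constants Q A B) /\
  (forall A' B', frame_constants Q A' B' -> A' <= A).

Definition upper_frame_bound (Q : 'cV[K]_n -> \bar R) (B : R) : Prop :=
  (exists A, frame_constants Q A B) /\
  (forall A' B', frame_constants Q A' B' -> B <= B').

Section Continuous.
Variables (d : measure_display) (Omega : measurableType d).
Variable mu : {measure set Omega -> \bar R}.

Definition mu_energy (phi : Omega -> 'cV[K]_n) (f : 'cV[K]_n) : \bar R :=
  (\int[mu]_x (modulus (inner f (phi x)) ^+ 2)%:E)%E.

Definition mu_frame (phi : Omega -> 'cV[K]_n) : Prop :=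
  measurable_fun [set: Omega]
    (phi : Omega -> g_sigma_algebraType (@open 'cV[K]_n)) /\
  exists A B : R, frame_constants (mu_energy phi) A B.

End Continuous.

Definition sum_energy N (v : 'I_N -> 'cV[K]_n) (f : 'cV[K]_n) : \bar R :=
  (\sum_(j < N) modulus (inner f (v j)) ^+ 2)%:E.

Definition discrete_frame N (v : 'I_N -> 'cV[K]_n) : Prop :=
  exists A B : R, frame_constants (sum_energy v) A B.

End Frames.

(* Main.v *)
Require Import Defs.
From mathcomp Require Import all_boot all_order all_algebra.
From mathcomp Require Import all_classical all_reals all_analysis.
From mathcomp Require Import measurable_realfun complex ring lra.

Import Order.TTheory GRing.Theory Num.Theory.
Import numFieldNormedType.Exports.

Local Open Scope classical_set_scope.
Local Open Scope ring_scope.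

Set Implicit Arguments.
Unset Strict Implicit.
Unset Printing Implicit Defensive.

(** The energy [|<f, v>|^2] of [f] against a single vector [v] is the quadratic
form of the rank one matrix [v v^*] at [f], so it is linear in that matrix.
Hence a weighted discrete system has the same energy as the continuous one,
and so the same frame bounds, as soon as the sum of the [s_j^2 phi(x_j)
phi(x_j)^*] equals the integral of [phi phi^*], a matrix that is finite
because the upper frame inequality and polarization make every entry
integrable.

The points and weights come from an exact form of Tchakaloff's theorem
([tchakaloff]): the integral of an integrable map into [R^m] lies in the convex
cone generated by its values, and not merely in the closure of that cone.  If
it did not, the cone and the integral would be weakly separated by a nonzero
linear functional ([cone_support]); the functional is nonnegative on the values
and has nonpositive integral, so it vanishes almost everywhere, and outside a
null set one coordinate is a combination of the others.  Induction on [m]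
concludes.  The cone need not be closed, so the separation is proved
algebraically; [cone_epigraph] is the finite-dimensional Hahn-Banach theorem
behind it.

The number of points is controlled by Caratheodory's reduction ([caratheodory]):
a conic representation of minimal length has positive coefficients and linearly
independent vectors.  This gives independence over the reals only, but the
matrices [v v^*] are Hermitian, so a complex relation between them splits into
two real ones ([outer_free]), and the length is at most the dimension of the
[K]-linear span. *)

(** * Linear functionals on row vectors *)
Section Pairing.
Variables (R : realType) (m : nat).
Implicit Types (v : 'rV[R]_m) (l : 'cV[R]_m).

Definition pairing v l : R := (v *m l) 0 0.

Lemma pairingE v l : pairing v l = \sum_i v 0 i * l i 0.
Proof. by rewrite /pairing mxE. Qed.

Lemma pairing0l l : pairing 0 l = 0.
Proof. by rewrite /pairing mul0mx mxE. Qed.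

Lemma pairingDl u v l : pairing (u + v) l = pairing u l + pairing v l.
Proof. by rewrite /pairing mulmxDl mxE. Qed.

Lemma pairingNl v l : pairing (- v) l = - pairing v l.
Proof. by rewrite /pairing mulNmx mxE. Qed.

Lemma pairingZl a v l : pairing (a *: v) l = a * pairing v l.
Proof. by rewrite /pairing -scalemxAl mxE. Qed.

Lemma pairing_suml (I : Type) (r : seq I) (F : I -> 'rV[R]_m) l :
  pairing (\sum_(j <- r) F j) l = \sum_(j <- r) pairing (F j) l.
Proof.
by apply: (big_morph (pairing^~ l)) => [u v|]; rewrite ?pairingDl ?pairing0l.
Qed.

End Pairing.

Lemma pairing_row (R : realType) (m : nat) (t c : R) (w : 'rV[R]_m)
    (l : 'cV[R]_m) :
  pairing (row_mx (t%:M : 'M[R]_1) w) (col_mx (c%:M : 'M[R]_1) l) =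
  t * c + pairing w l.
Proof. by rewrite /pairing mul_row_col mxE -scalar_mxM mxE mulr1n. Qed.

Lemma row_mx1_surj (R : realType) m (v : 'rV[R]_(1 + m)) :
  exists (t : R) (w : 'rV[R]_m), v = row_mx (t%:M : 'M[R]_1) w.
Proof.
by exists (lsubmx v 0 0), (rsubmx v); rewrite -mx11_scalar hsubmxK.
Qed.

(** * Supporting functionals of convex cones *)
Section ConvexCones.
Variable R : realType.

Lemma real_between (S U : set R) :
  S !=set0 -> U !=set0 -> (forall s u, S s -> U u -> s <= u) ->
  exists c, (forall s, S s -> s <= c) /\ (forall u, U u -> c <= u).
Proof.
move=> S0 [u0 Uu0] SU; exists (sup S); split=> [s Ss|u Uu].
  by apply: ub_le_sup => //; exists u0 => s' Ss'; exact: SU.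
by apply: ge_sup => // s Ss; exact: SU.
Qed.

(** Hahn-Banach in finite dimension, with the sublinear function replaced by a
cone [C] that plays the part of its epigraph; no infimum along the fibres of
[C] is then needed.  The functional is extended one coordinate at a time: its
value [c] on a new basis vector has to lie above a family of numbers coming
from the slice at height -1 and below one coming from the slice at height 1,
and adding points of the two slices shows that these families are separated. *)
Lemma cone_epigraph m (C : R -> 'rV[R]_m -> Prop) :
  (forall s u t v, C s u -> C t v -> C (s + t) (u + v)) ->
  (forall a t v, 0 < a -> C t v -> C (a * t) (a *: v)) ->
  (forall v, exists t, C t v) -> ~ C (- 1) 0 ->
  exists l : 'cV[R]_m, forall t v, C t v -> pairing v l <= t.
Proof.
elim: m C => [|m IHm]; last rewrite -[m.+1]/(1 + m)%N;
  move=> C CD CZ Cfull C0.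
  exists 0 => t v; rewrite [v]thinmx0 pairing0l => Ct.
  rewrite leNgt; apply/negP => t0; apply: C0.
  have it0 : 0 < (- t)^-1 by rewrite invr_gt0 oppr_gt0.
  by have := CZ _ _ _ it0 Ct; rewrite scaler0 invrN mulNr mulVf ?lt_eqF.
pose C' t w := C t (row_mx (0%:M : 'M[R]_1) w : 'rV[R]_(1 + m)).
have [||||l lP] := IHm C'.
- by move=> s u t v Cs Ct; have := CD _ _ _ _ Cs Ct;
    rewrite add_row_mx -raddfD addr0.
- by move=> a t v a0 Ct; have := CZ _ _ _ a0 Ct;
    rewrite scale_row_mx scale_scalar_mx mulr0.
- by move=> v; exact: Cfull.
- by rewrite /C' raddf0 row_mx0.
pose S := [set s | exists t w,
  C t (row_mx ((-1)%:M : 'M[R]_1) w : 'rV[R]_(1 + m)) /\ s = pairing w l - t].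
pose U := [set s | exists t w,
  C t (row_mx (1%:M : 'M[R]_1) w : 'rV[R]_(1 + m)) /\ s = t - pairing w l].
have [||s u [t [w [Ct ->]]] [t' [w' [Ct' ->]]]|c [Sc cU]] :=
  @real_between S U.
- have [t Ct] := Cfull (row_mx ((-1)%:M : 'M[R]_1) (0 : 'rV[R]_m)).
  by eexists; exists t, 0.
- have [t Ct] := Cfull (row_mx (1%:M : 'M[R]_1) (0 : 'rV[R]_m)).
  by eexists; exists t, 0.
- have : pairing (w + w') l <= t + t'.
    apply: lP; rewrite /C'; have := CD _ _ _ _ Ct Ct'.
    by rewrite add_row_mx -raddfD addNr.
  rewrite pairingDl; lra.
exists (col_mx (c%:M : 'M[R]_1) l : 'cV[R]_(1 + m)) => t v.
have [a [w ->]] := @row_mx1_surj R m v => Ct.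
rewrite pairing_row.
have CZa b : 0 < b -> C (b^-1 * t)
    (row_mx ((b^-1 * a)%:M : 'M[R]_1) (b^-1 *: w) : 'rV[R]_(1 + m)).
  move=> b0; have := CZ b^-1 _ _ _ Ct.
  by rewrite invr_gt0 scale_row_mx scale_scalar_mx; exact.
have [a0|a0|a0] := ltgtP a 0.
- have Na0 : 0 < - a by rewrite oppr_gt0.
  have := Sc ((- a)^-1 * (pairing w l - t)).
  rewrite ler_pdivrMl// => H.
  suff: pairing w l - t <= - a * c by lra.
  apply: H; exists ((- a)^-1 * t), ((- a)^-1 *: w); split.
    have -> : -1 = (- a)^-1 * a by rewrite invrN mulNr mulVf ?lt_eqF.
    exact: CZa.
  by rewrite pairingZl mulrBr.
- have := cU (a^-1 * (t - pairing w l)).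
  rewrite ler_pdivlMl// => H.
  suff: a * c <= t - pairing w l by lra.
  apply: H; exists (a^-1 * t), (a^-1 *: w); split.
    by have := CZa _ a0; rewrite mulVf ?gt_eqF.
  by rewrite pairingZl mulrBr.
- by rewrite a0 mul0r add0r; apply: lP; rewrite /C' -a0.
Qed.

Definition convex_cone (V : lmodType R) (C : set V) : Prop :=
  [/\ C 0, forall u v, C u -> C v -> C (u + v) &
      forall a u, 0 <= a -> C u -> C (a *: u)].

(** By induction on the dimension, project along the first axis.  If the projection is proper, a functional for it can be pulled
back.  If it is everything, then [C] omits one of the two directions of the
axis, since otherwise it would be the whole space, and [C] lies on one side of
the graph of a linear map. *)
Lemma cone_support m (C : set 'rV[R]_m) :
  convex_cone C -> (exists v, ~ C v) ->
  exists2 l : 'cV[R]_m, l != 0 & forall v, C v -> 0 <= pairing v l.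
Proof.
elim: m C => [|m IHm]; last rewrite -[m.+1]/(1 + m)%N;
  move=> C [C0 CD CZ] [v nCv].
  by exfalso; apply: nCv; rewrite [v]thinmx0.
pose P := [set w | exists t : R,
  C (row_mx (t%:M : 'M[R]_1) w : 'rV[R]_(1 + m))].
have [Pfull|] := pselect (forall w, P w); last first.
  move=> /existsNP nP; have [|l l0 lP] := IHm P _ nP.
    split; first by exists 0; rewrite raddf0 row_mx0.
    - move=> u w [s Cs] [t Ct]; exists (s + t).
      by have := CD _ _ Cs Ct; rewrite add_row_mx -raddfD.
    - move=> a u a0 [s Cs]; exists (a * s).
      by have := CZ _ _ a0 Cs; rewrite scale_row_mx scale_scalar_mx.
  exists (col_mx (0%:M : 'M[R]_1) l : 'cV[R]_(1 + m)).
    by rewrite col_mx_eq0 negb_and l0 orbT.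
  move=> u; have [a [w ->]] := @row_mx1_surj R m u => Cu.
  by rewrite pairing_row mulr0 add0r; apply: lP; exists a.
(* With both directions of the first axis in [C], every fibre of the projection
   would be a full line and [C] the whole space. *)
have [s [ss1 nCs]] : exists s : R,
    s * s = 1 /\ ~ C (row_mx ((- s)%:M : 'M[R]_1) 0 : 'rV[R]_(1 + m)).
  apply: contrapT => /forallNP nex; apply: nCv.
  have Cx (x : R) : C (row_mx (x%:M : 'M[R]_1) 0 : 'rV[R]_(1 + m)).
    have Cs s : s * s = 1 -> C (row_mx (s%:M : 'M[R]_1) 0 : 'rV[R]_(1 + m)).
      move=> ss1; apply: contrapT => nC; apply: (nex (- s)).
      by rewrite mulrNN opprK.
    have [x0|x0] := leP 0 x.
      have := CZ _ _ x0 (Cs 1 (mulr1 _)).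
      by rewrite scale_row_mx scaler0 scale_scalar_mx mulr1.
    have Nx0 : 0 <= - x by rewrite oppr_ge0 ltW.
    have := CZ _ _ Nx0 (Cs (- 1) _); rewrite mulrNN mulr1 => /(_ erefl).
    by rewrite scale_row_mx scaler0 scale_scalar_mx mulrNN mulr1.
  have [a [w ->]] := @row_mx1_surj R m v.
  have [t Ct] := Pfull w.
  have := CD _ _ Ct (Cx (a - t)).
  by rewrite add_row_mx addr0 -raddfD addrC subrK.
have [||||l lP] := @cone_epigraph m
    (fun t w => C (row_mx ((s * t)%:M : 'M[R]_1) w : 'rV[R]_(1 + m))).
- move=> t u t' v' Ct Ct'; have := CD _ _ Ct Ct'.
  by rewrite add_row_mx -raddfD -mulrDr.
- move=> a t u a0 Ct; have := CZ _ _ (ltW a0) Ct.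
  by rewrite scale_row_mx scale_scalar_mx mulrCA.
- move=> w; have [t Ct] := Pfull w; exists (s * t).
  by rewrite mulrA ss1 mul1r.
- by rewrite mulrN1.
exists (col_mx (s%:M : 'M[R]_1) (- l) : 'cV[R]_(1 + m)).
  rewrite col_mx_eq0 negb_and; apply/orP; left.
  apply/eqP => /matrixP/(_ 0 0); rewrite !mxE mulr1n => s0.
  by move: ss1; rewrite s0 mulr0 => /esym/eqP; rewrite oner_eq0.
move=> u; have [a [w ->]] := @row_mx1_surj R m u => Cu.
rewrite pairing_row; have := lP (s * a) w; rewrite mulrA ss1 mul1r => /(_ Cu).
by rewrite /pairing mulmxN [X in _ <= _ + X]mxE mulrC subr_ge0.
Qed.

End ConvexCones.

(** * Conic combinations and Caratheodory's reduction *)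
Section ConicCombinations.
Variables (R : realType) (V : lmodType R) (T : Type) (F : T -> V) (D : set T).

Definition conic_comb N (b : V) : Prop :=
  exists (x : 'I_N -> T) (c : 'I_N -> R),
    [/\ forall j, D (x j), forall j, 0 <= c j & b = \sum_j c j *: F (x j)].

Lemma conic_comb_generator x : D x -> conic_comb 1 (F x).
Proof.
move=> Dx; exists (fun=> x), (fun=> 1); split=> //.
by rewrite big_ord1 scale1r.
Qed.

Lemma convex_cone_conic_comb : convex_cone [set b | exists N, conic_comb N b].
Proof.
split=> [|u v [M [x [c [Dx c0 ->]]]] [N [y [e [Dy e0 ->]]]]|].
- exists 0%N, (fun j : 'I_0 => False_rect T (notF (ltn_ord j))), (fun=> 0);
    by split=> [[]|[]|] //; rewrite big_ord0.
- exists (M + N)%N.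
  exists (fun j => match fintype.split j with inl i => x i | inr i => y i end).
  exists (fun j => match fintype.split j with inl i => c i | inr i => e i end).
  split=> [j|j|]; [by case: fintype.split | by case: fintype.split |].
  rewrite big_split_ord; congr (_ + _); apply: eq_bigr => i _.
    by rewrite -[lshift _ _]/(unsplit (inl _)) unsplitK.
  by rewrite -[rshift _ _]/(unsplit (inr _)) unsplitK.
- move=> a _ a0 [N [x [c [Dx c0 ->]]]].
  exists N, x, (fun j => a * c j); split=> // [j|]; first exact: mulr_ge0.
  by rewrite scaler_sumr; apply: eq_bigr => j _; rewrite scalerA.
Qed.

Lemma conic_comb_drop N (x : 'I_N.+1 -> T) (c : 'I_N.+1 -> R) j0 :
  (forall j, D (x j)) -> (forall j, 0 <= c j) -> c j0 = 0 ->
  conic_comb N (\sum_j c j *: F (x j)).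
Proof.
move=> Dx c0 cj0; exists (x \o lift j0), (c \o lift j0); split=> // [j|j|].
- exact: Dx.
- exact: c0.
- by rewrite (bigD1_ord j0) //= cj0 scale0r add0r.
Qed.

(** A representation of minimal length has no zero coefficient, as such a term
could be dropped.  Nor are its vectors dependent: if [r] is a relation with
some positive entry, subtract from the coefficients the largest multiple of [r]
that keeps them nonnegative; one of them becomes zero. *)
Lemma caratheodory N b : conic_comb N b ->
  exists M (x : 'I_M -> T) (c : 'I_M -> R),
    [/\ forall j, D (x j), forall j, 0 < c j, b = \sum_j c j *: F (x j) &
        forall r : 'I_M -> R, \sum_j r j *: F (x j) = 0 -> forall j, r j = 0].
Proof.
move=> bN; have exb : exists n, `[< conic_comb n b >].
  by exists N; apply/asboolP.
case: (ex_minnP exb) => M /asboolP[x [c [Dx c0 bE]]] Mmin.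
have Mshort M' : (M' < M)%N -> ~ conic_comb M' b.
  by move=> MM' bM'; move: MM'; rewrite ltnNge Mmin//; apply/asboolP.
have cpos (e : 'I_M -> R) : (forall j, 0 <= e j) ->
    b = \sum_j e j *: F (x j) -> forall j, 0 < e j.
  move=> e0 bEe j; rewrite lt_neqAle e0 andbT eq_sym; apply/eqP => ej0.
  clear Mmin bE c0.
  case: M x c Dx Mshort e e0 bEe j ej0 => [|M] x c Dx Mshort e e0 bEe j ej0.
    by case: j ej0.
  by apply: (Mshort M) => //; rewrite bEe; apply: (conic_comb_drop _ _ ej0).
exists M, x, c; split=> //; first exact: cpos.
have main (r : 'I_M -> R) : \sum_j r j *: F (x j) = 0 -> forall j, r j <= 0.
  move=> rF j; rewrite leNgt; apply/negP => rj.
  have [i ri imin] :=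
    @arg_minP _ _ _ j (fun i => 0 < r i) (fun i => c i / r i) rj.
  pose t := c i / r i.
  have t0 : 0 <= t by rewrite divr_ge0 // ltW.
  pose e l := c l - t * r l.
  have e0 l : 0 <= e l.
    rewrite subr_ge0; have [rl|rl] := ltP 0 (r l).
      by rewrite -ler_pdivlMr//; exact: imin.
    by apply: le_trans (c0 l); rewrite mulr_ge0_le0.
  suff eE : b = \sum_l e l *: F (x l).
    by have := cpos e e0 eE i; rewrite /e /t divfK ?gt_eqF// subrr ltxx.
  rewrite (eq_bigr (fun l => c l *: F (x l) - t *: (r l *: F (x l)))).
    by rewrite sumrB -scaler_sumr rF scaler0 subr0.
  by move=> l _; rewrite scalerBl scalerA.
move=> r rF j; apply/eqP; rewrite eq_le main//=.
rewrite -oppr_le0; apply: (main (fun j => - r j)).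
by under eq_bigr do rewrite scaleNr; rewrite sumrN rF oppr0.
Qed.

End ConicCombinations.

(** * Integrals lie in the cone of values *)
Section Tchakaloff.
Variables (R : realType) (d : measure_display) (T : measurableType d).
Variable mu : {measure set T -> \bar R}.

Definition row_Rintegral m (D : set T) (F : T -> 'rV[R]_m) : 'rV[R]_m :=
  \row_i (\int[mu]_(x in D) F x 0 i)%R.

Definition row_integrable m (D : set T) (F : T -> 'rV[R]_m) : Prop :=
  forall i, mu.-integrable D (fun x => (F x 0 i)%:E).

Lemma Rintegral_pairing m (D : set T) (F : T -> 'rV[R]_m) (l : 'cV[R]_m) :
  measurable D -> row_integrable D F ->
  mu.-integrable D (fun x => (pairing (F x) l)%:E) /\
  (\int[mu]_(x in D) pairing (F x) l)%R = pairing (row_Rintegral D F) l.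
Proof.
move=> mD iF.
suff [H1 H2] : mu.-integrable D (fun x => (\sum_i F x 0 i * l i 0)%:E) /\
    (\int[mu]_(x in D) \sum_i F x 0 i * l i 0)%R =
    \sum_i row_Rintegral D F 0 i * l i 0.
  split; first by under eq_fun do rewrite pairingE.
  by under eq_Rintegral do rewrite pairingE; rewrite H2 pairingE.
elim: (index_enum _) => [|i s [ints Es]].
  split; first by under eq_fun do rewrite big_nil; exact: integrable0.
  under eq_Rintegral do rewrite big_nil.
  by rewrite big_nil Rintegral_cst// mul0r.
have ii : mu.-integrable D (fun x => (F x 0 i * l i 0)%:E).
  under eq_fun do rewrite mulrC EFinM.
  exact: integrableZl (iF i).
split.
  under eq_fun do rewrite big_cons EFinD.
  exact: integrableD.
under eq_Rintegral do rewrite big_cons.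
rewrite RintegralD// Es big_cons; congr (_ + _).
by rewrite RintegralZr ?mxE//; exact: iF.
Qed.

Lemma ge0_Rintegral_eq0 (D : set T) (g : T -> R) :
  measurable D -> mu.-integrable D (EFin \o g) ->
  (forall x, D x -> 0 <= g x) -> (\int[mu]_(x in D) g x)%R <= 0 ->
  exists N, [/\ measurable N, mu N = 0 & forall x, (D `\` N) x -> g x = 0].
Proof.
move=> mD ig g0 intg.
have intg0 : (\int[mu]_(x in D) `|(EFin \o g) x| = 0)%E.
  have -> : (\int[mu]_(x in D) `|(EFin \o g) x| = \int[mu]_(x in D) (g x)%:E)%E.
    by apply: eq_integral => x /set_mem Dx; rewrite /= ger0_norm// g0.
  rewrite -[LHS]fineK; last exact: integrable_fin_num.
  congr EFin; apply/eqP; rewrite eq_le; apply/andP; split=> //.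
  exact: Rintegral_ge0.
have [N [mN N0 subN]] :=
  (ae_eq_integral_abs mu mD (measurable_int mu ig)).1 intg0.
exists N; split=> // x [Dx nNx]; apply: contrapT => gx; apply: nNx.
by apply: subN => /= /(_ Dx) [].
Qed.

Lemma col'_row_integrable m (D : set T) (F : T -> 'rV[R]_m) i :
  row_integrable D F -> row_integrable D (col' i \o F).
Proof.
move=> iF j; have := iF (lift i j).
by under [X in _ -> integrable _ _ X]eq_fun do rewrite /= mxE.
Qed.

Lemma pairing_col'_inj m (u v : 'rV[R]_m) (l : 'cV[R]_m) i :
  l i 0 != 0 -> pairing u l = pairing v l -> col' i u = col' i v -> u = v.
Proof.
move=> li uvl uv.
have uvj j : j != i -> u 0 j = v 0 j.
  rewrite eq_sym => /unlift_some[j' -> _].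
  by have /rowP/(_ j') := uv; rewrite !mxE.
apply/rowP => j; have [->|/uvj//] := eqVneq j i.
move: uvl; rewrite !pairingE (bigD1 i)//= [RHS](bigD1 i)//=.
rewrite [X in _ + X = _](eq_bigr (fun j => v 0 j * l j 0)); last first.
  by move=> j' /uvj ->.
by move=> /addIr/(mulIf li).
Qed.

(** The domain [D] varies because the induction on [m] removes a null set, on
whose complement a functional [l] kills the values of [F]; there a coordinate
on which [l] does not vanish is determined by the others. *)
Theorem tchakaloff m (D : set T) (F : T -> 'rV[R]_m) :
  measurable D -> row_integrable D F ->
  exists N, conic_comb F D N (row_Rintegral D F).
Proof.
elim: m D F => [|m IHm] D F mD iF.
  by rewrite [row_Rintegral _ _]thinmx0; have [] := convex_cone_conic_comb F D.
set I := row_Rintegral D F; set hull := [set b | exists N, conic_comb F D N b].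
apply: contrapT => nI.
have [hull0 hullD hullZ] : convex_cone hull by exact: convex_cone_conic_comb.
(* The cone [C] is the hull enlarged by the ray through [- I]; it omits [I],
   because [I + t I] in the hull would put [I] there. *)
pose C := [set u : 'rV[R]_m.+1 | exists2 t : R, 0 <= t & hull (u + t *: I)].
have [||l l0 lC] := @cone_support R m.+1 C.
- split; first by exists 0 => //; rewrite scale0r addr0.
  + move=> u v [s s0 hu] [t t0 hv]; exists (s + t); first exact: addr_ge0.
    by rewrite scalerDl addrACA; exact: hullD.
  + move=> a u a0 [s s0 hu]; exists (a * s); first exact: mulr_ge0.
    by rewrite -scalerA -scalerDr; exact: hullZ.
- exists I => -[t t0 h]; apply: nI.
  have t1 : 0 < 1 + t by rewrite ltr_wpDr.
  have := hullZ (1 + t)^-1 _ _ h; rewrite invr_ge0 ltW// => /(_ isT).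
  by rewrite -{1}[I]scale1r -scalerDl scalerA mulVf ?gt_eqF// scale1r.
have [ig Eg] := Rintegral_pairing l mD iF.
have g0 x : D x -> 0 <= pairing (F x) l.
  move=> Dx; apply: lC; exists 0 => //; rewrite scale0r addr0.
  by exists 1%N; exact: conic_comb_generator.
have Ig : pairing I l <= 0.
  rewrite -oppr_ge0 -pairingNl; apply: lC; exists 1 => //.
  by rewrite scale1r addNr.
have [|N [mN N0 gN]] := ge0_Rintegral_eq0 mD ig g0; first by rewrite Eg.
have mDN : measurable (D `\` N) by exact: measurableD.
have iDN : row_integrable (D `\` N) F.
  by move=> i; apply: integrableS (iF i) => //; exact: subDsetl.
have IDN : row_Rintegral (D `\` N) F = I.
  apply/rowP => i; rewrite !mxE /Rintegral.
  by rewrite [in RHS](negligible_integral mN)//; exact: iF.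
have [i li] : exists i, l i 0 != 0.
  by have /cV0Pn := l0.
have [M [x [c [Dx c0 cE]]]] := IHm _ _ mDN (@col'_row_integrable _ _ _ i iDN).
apply: nI; exists M, x, c; split=> // [j|]; first by have [] := Dx j.
apply: (pairing_col'_inj li).
  rewrite pairing_suml big1 => [|j _]; last first.
    by rewrite pairingZl gN ?mulr0//; exact: Dx.
  rewrite -IDN -(Rintegral_pairing l mDN iDN).2.
  rewrite (@eq_Rintegral _ _ _ _ _ (fun=> 0)) ?Rintegral_cst ?mul0r//.
  by move=> y /set_mem; exact: gN.
rewrite -IDN linear_sum; under [RHS]eq_bigr do rewrite linearZ.
rewrite -cE; apply/rowP => j; rewrite !mxE.
by under [in RHS]eq_Rintegral do rewrite mxE.
Qed.

End Tchakaloff.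

(** * Real and imaginary parts for both kinds of scalars *)
Section Scalars.
Variables (R : realType) (k : scalar_kind).
Local Notation K := (scalar_field R k).
Local Notation conj := (@sconj R k).
Local Notation "r %:K" := (@of_real R k r) (at level 1, format "r %:K").

Definition sre : K -> R :=
  match k return scalar_field R k -> R with
  | RealScalars => fun x => x
  | ComplexScalars => fun z => complex.Re z
  end.

Definition sim : K -> R :=
  match k return scalar_field R k -> R with
  | RealScalars => fun=> 0
  | ComplexScalars => fun z => complex.Im z
  end.

(** Zero for real scalars.  With this convention [imag_unit * z] has real part
[- sim z] for both kinds, so that real and complex scalars share the
remaining arguments. *)
Definition imag_unit : K :=
  match k return scalar_field R k with
  | RealScalars => 0
  | ComplexScalars => Complex 0 1
  end.

Lemma scalar_eqP (z w : K) : sre z = sre w -> sim z = sim w -> z = w.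
Proof.
rewrite /sre /sim; case: k z w => //= -[a b] [c e] /= -> -> //.
Qed.

Lemma sreD z w : sre (z + w) = sre z + sre w.
Proof. by rewrite /sre; case: k z w => //= -[a b] [c e]. Qed.

Lemma simD z w : sim (z + w) = sim z + sim w.
Proof.
by rewrite /sim; case: k z w => [z w|[a b] [c e]] //=; rewrite addr0.
Qed.

Lemma sre0 : sre 0 = 0. Proof. by rewrite /sre; case: k. Qed.

Lemma sim0 : sim 0 = 0. Proof. by rewrite /sim; case: k. Qed.

Lemma sreM z w : sre (z * w) = sre z * sre w - sim z * sim w.
Proof.
by rewrite /sre /sim; case: k z w => [z w|[a b] [c e]] //=; rewrite mulr0 subr0.
Qed.

Lemma simM z w : sim (z * w) = sre z * sim w + sim z * sre w.
Proof.
by rewrite /sre /sim; case: k z w => [z w|[a b] [c e]] //=;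
  rewrite !(mulr0, mul0r) addr0.
Qed.

Lemma sre_of_real a : sre a%:K = a.
Proof. by rewrite /sre /of_real; case: k. Qed.

Lemma sim_of_real a : sim a%:K = 0.
Proof. by rewrite /sim /of_real; case: k. Qed.

Lemma sre_conj z : sre (conj z) = sre z.
Proof. by rewrite /sre /sconj; case: k z => // -[]. Qed.

Lemma sim_conj z : sim (conj z) = - sim z.
Proof. by rewrite /sim /sconj; case: k z => [z|[]] //; rewrite oppr0. Qed.

Lemma sre_imag_unitM z : sre (imag_unit * z) = - sim z.
Proof.
by rewrite sreM /sre /sim /imag_unit; case: k z => [z|[a b]] //=;
  rewrite mul0r ?mul1r ?mul0r sub0r.
Qed.

Lemma modulus_sqE z : modulus z ^+ 2 = sre z ^+ 2 + sim z ^+ 2.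
Proof.
rewrite /modulus /sre /sim; case: k z => [z|[a b]] /=.
  by rewrite expr0n addr0 real_normK// num_real.
by rewrite sqr_sqrtr// addr_ge0// sqr_ge0.
Qed.

Lemma normE (z : K) : `|z| = (modulus z)%:K.
Proof. by rewrite /modulus /of_real; case: k z. Qed.

Lemma of_real_lt (a b : R) : (a%:K < b%:K) = (a < b).
Proof. by rewrite /of_real; case: k => //; rewrite ltcR. Qed.

Lemma of_real_le (a b : R) : (a%:K <= b%:K) = (a <= b).
Proof. by rewrite /of_real; case: k => //; rewrite lecR. Qed.

Lemma of_realB (a b : R) : (a - b)%:K = a%:K - b%:K.
Proof. by rewrite /of_real; case: k => //=; rewrite rmorphB. Qed.

Lemma modulusB_le (z w : K) : `|modulus z - modulus w| <= modulus (z - w).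
Proof.
have half (u v : K) : modulus u - modulus v <= modulus (u - v) :> R.
  by rewrite -of_real_le of_realB -!normE lerB_dist.
rewrite ler_norml half andbT lerNl opprB.
suff -> : modulus (z - w) = modulus (w - z) :> R by exact: half.
have : (modulus (z - w))%:K = (modulus (w - z))%:K by rewrite -!normE distrC.
by move=> /(congr1 sre); rewrite !sre_of_real.
Qed.

(** The library norm of [K] is the modulus embedded in [K], so that a
neighbourhood in [K] is cut out by a real radius. *)
Lemma modulus_continuous : continuous (@modulus R k : K -> R).
Proof.
move=> z; have zF : Filter (nbhs z) by exact: nbhs_filter.
apply/(@cvgrPdist_lt R R K (nbhs z) zF) => e e0.
have eK0 : 0 < e%:K.
  suff <- : (0 : R)%:K = 0 by rewrite of_real_lt.
  by apply: scalar_eqP; rewrite ?sre_of_real ?sim_of_real ?sre0 ?sim0.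
near=> w; apply: (le_lt_trans (modulusB_le _ _)).
rewrite -of_real_lt -normE; near: w.
exact: (@cvgr_dist_lt K K _ (nbhs z)).
Unshelve. all: by end_near. Qed.

Lemma sconjD z w : conj (z + w) = conj z + conj w.
Proof.
by apply: scalar_eqP; rewrite !(sre_conj, sim_conj, sreD, simD) ?opprD.
Qed.

Lemma sconjM z w : conj (z * w) = conj z * conj w.
Proof.
apply: scalar_eqP; rewrite !(sre_conj, sim_conj, sreM, simM); ring.
Qed.

Lemma sconj0 : conj 0 = 0.
Proof. by apply: scalar_eqP; rewrite ?sre_conj ?sim_conj ?sim0 ?oppr0. Qed.

Lemma sconjK : involutive conj.
Proof.
by move=> z; apply: scalar_eqP; rewrite !(sre_conj, sim_conj) ?opprK.
Qed.

Lemma sconj_sum (I : Type) (r : seq I) (F : I -> K) :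
  conj (\sum_(i <- r) F i) = \sum_(i <- r) conj (F i).
Proof. exact: (big_morph conj sconjD sconj0). Qed.

Lemma sconj_of_real a : conj a%:K = a%:K.
Proof.
by apply: scalar_eqP; rewrite ?sre_conj ?sim_conj ?sim_of_real ?oppr0.
Qed.

Lemma modulus_sq_conj z : modulus (conj z) ^+ 2 = modulus z ^+ 2 :> R.
Proof. by rewrite !modulus_sqE sre_conj sim_conj sqrrN. Qed.

Lemma modulus_sqM_conj (z : K) : (modulus z ^+ 2)%:K = z * conj z.
Proof.
apply: scalar_eqP;
  rewrite ?(sreM, simM, sre_of_real, sim_of_real) sre_conj sim_conj.
  by rewrite modulus_sqE; ring.
by ring.
Qed.

Lemma modulus_sq_of_realM a (z : K) :
  modulus (a%:K * z) ^+ 2 = a ^+ 2 * modulus z ^+ 2 :> R.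
Proof.
by rewrite !modulus_sqE sreM simM sre_of_real sim_of_real; ring.
Qed.

Lemma sre_polarization (z w : K) :
  sre (z * conj w) = 4^-1 * (modulus (z + w) ^+ 2 - modulus (z + - w) ^+ 2).
Proof.
have sreN u : sre (- u) = - sre u.
  by apply/eqP; rewrite -addr_eq0 -sreD addNr sre0.
have simN u : sim (- u) = - sim u.
  by apply/eqP; rewrite -addr_eq0 -simD addNr sim0.
rewrite !modulus_sqE !sreD !simD sreN simN sreM sre_conj sim_conj; lra.
Qed.

Lemma sre_sum (I : Type) (r : seq I) (F : I -> K) :
  sre (\sum_(i <- r) F i) = \sum_(i <- r) sre (F i).
Proof. exact: (big_morph sre sreD sre0). Qed.

End Scalars.

(** * Rank one matrices *)
Section Outer.
Variables (R : realType) (k : scalar_kind) (n : nat).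
Local Notation K := (scalar_field R k).
Local Notation conj := (@sconj R k).
Local Notation "r %:K" := (@of_real R k r) (at level 1, format "r %:K").

Definition outer (v : 'cV[K]_n) : 'M[K]_n := v *m adjoint v.

Lemma outerE v i j : outer v i j = v i 0 * conj (v j 0).
Proof. by rewrite /outer mxE big_ord1 !mxE. Qed.

(** A matrix over [K] as a real vector, the setting in which cones and integrals
are treated. *)
Definition realify (M : 'M[K]_n) : 'rV[R]_(n * (n + n)) :=
  mxvec (row_mx (map_mx (@sre R k) M) (map_mx (@sim R k) M)).

Lemma realify0 : realify 0 = 0.
Proof.
rewrite /realify -[RHS](linear0 mxvec) -row_mx0.
by congr (mxvec (row_mx _ _)); apply/matrixP => i j; rewrite !mxE ?sre0 ?sim0.
Qed.

Lemma realifyD M N : realify (M + N) = realify M + realify N.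
Proof.
rewrite /realify -linearD add_row_mx.
by congr (mxvec (row_mx _ _)); apply/matrixP => i j; rewrite !mxE ?sreD ?simD.
Qed.

Lemma realifyZ a M : realify (a%:K *: M) = a *: realify M.
Proof.
rewrite /realify -linearZ scale_row_mx.
congr (mxvec (row_mx _ _)); apply/matrixP => i j; rewrite !mxE ?sreM ?simM.
  by rewrite sre_of_real sim_of_real mul0r subr0.
by rewrite sre_of_real sim_of_real mul0r addr0.
Qed.

Lemma realify_sum N (c : 'I_N -> R) (M : 'I_N -> 'M[K]_n) :
  realify (\sum_j (c j)%:K *: M j) = \sum_j c j *: realify (M j).
Proof.
rewrite (big_morph realify realifyD realify0).
by apply: eq_bigr => j _; rewrite realifyZ.
Qed.

Lemma pairing_mxvec m p (M N : 'M[R]_(m, p)) :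
  pairing (mxvec M) (mxvec N)^T = \sum_i \sum_j M i j * N i j.
Proof.
rewrite pairingE (reindex _ (curry_mxvec_bij _ _)) pair_bigA /=.
by apply: eq_bigr => -[i j] _ /=; rewrite !mxE !mxvecE.
Qed.

(** The squared modulus is the value at [f] of the quadratic form of [v v^*],
hence a real linear form in the entries of that matrix. *)
Lemma modulus_sq_inner_linear f : exists l, forall v,
  modulus (inner f v) ^+ 2 = pairing (realify (outer v)) l.
Proof.
pose W i j := conj (f i 0) * f j 0.
pose Wre := \matrix_(i, j) sre (W i j).
pose Wim := \matrix_(i, j) - sim (W i j).
exists (mxvec (row_mx Wre Wim))^T => v.
rewrite pairing_mxvec.
have -> : modulus (inner f v) ^+ 2 = sre (conj (inner f v) * inner f v).
  by rewrite mulrC -modulus_sqM_conj sre_of_real.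
rewrite /inner sconj_sum big_distrlr /= sre_sum; apply: eq_bigr => i _.
rewrite sre_sum big_split_ord /= -big_split /=; apply: eq_bigr => j _.
rewrite !row_mxEl !row_mxEr ![map_mx _ _ _ _]mxE [Wre _ _]mxE [Wim _ _]mxE.
rewrite outerE mulrN.
rewrite [in RHS]mulrC [X in _ = _ - X]mulrC -sreM sconjM sconjK.
by congr sre; rewrite -!mulrA; congr (_ * _); rewrite mulrCA; congr (_ * _).
Qed.

(** Taking adjoints of a relation, as the matrices are Hermitian. *)
Lemma conj_relation N (v : 'I_N -> 'cV[K]_n) (a : 'I_N -> K) :
  \sum_j a j *: outer (v j) = 0 -> \sum_j conj (a j) *: outer (v j) = 0.
Proof.
move=> rel; apply/matrixP => p q.
have := congr1 conj (congr1 (fun M : 'M[K]_n => M q p) rel).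
rewrite !mxE sconj0 => <-; rewrite !summxE sconj_sum.
apply: eq_bigr => j _; rewrite ![(_ *: outer _) _ _]mxE !outerE !sconjM sconjK.
by rewrite mulrA mulrAC -mulrA.
Qed.

(** A relation over [K] and its conjugate together give the relations with
coefficients [sre (a j)]; multiplying by [imag_unit] gives those with
coefficients [sim (a j)]. *)
Lemma outer_free N (v : 'I_N -> 'cV[K]_n) :
  (forall r : 'I_N -> R, \sum_j r j *: realify (outer (v j)) = 0 ->
    forall j, r j = 0) ->
  forall a : 'I_N -> K, \sum_j a j *: outer (v j) = 0 -> forall j, a j = 0.
Proof.
move=> vfree.
have sre_eq0 (a : 'I_N -> K) :
    \sum_j a j *: outer (v j) = 0 -> forall j, sre (a j) = 0.
  move=> rel; apply: vfree; rewrite -realify_sum -realify0; congr realify.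
  have sreE z : (sre z)%:K = (2^-1)%:K * (z + conj z).
    apply: scalar_eqP.
      by rewrite sreM !sre_of_real sim_of_real sreD sre_conj; field.
    by rewrite simM !sre_of_real !sim_of_real simD sim_conj; field.
  under eq_bigr do rewrite sreE -scalerA scalerDl.
  by rewrite -scaler_sumr big_split /= rel conj_relation// addr0 scaler0.
move=> a rel j; apply: scalar_eqP; rewrite ?sre0 ?sim0; first exact: sre_eq0.
apply/eqP; rewrite -oppr_eq0 -sre_imag_unitM; apply/eqP.
apply: (sre_eq0 (fun j => imag_unit R k * a j)).
by under eq_bigr do rewrite -scalerA; rewrite -scaler_sumr rel scaler0.
Qed.

Lemma outer_dim (T : Type) (phi : T -> 'cV[K]_n) N (x : 'I_N -> T) :
  (forall a : 'I_N -> K, \sum_j a j *: outer (phi (x j)) = 0 ->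
    forall j, a j = 0) ->
  (N <= \dim (lin_span [set phi y *m adjoint (phi y) | y in [set: T]]))%N.
Proof.
move=> ind; pose X := [tuple outer (phi (x j)) | j < N].
have freeX : free X.
  apply/freeP => a rel; apply: ind; rewrite -[RHS]rel.
  by apply: eq_bigr => j _; rewrite -tnth_nth tnth_mktuple.
have /eqP <- : \dim <<X>> == N by move: freeX; rewrite /free size_tuple.
apply: dimvS; apply/span_subvP => _ /mapP[j _ ->].
apply/(lin_spanP [set phi y *m adjoint (phi y) | y in [set: T]]).
exists [:: outer (phi (x j))]; last by rewrite memv_span ?mem_head.
by move=> w; rewrite inE => /eqP ->; exists (x j).
Qed.

(** The conjugate of the inner product, which has the same modulus, is a
polynomial in the coordinates of [v]. *)
Lemma modulus_sq_innerE (f v : 'cV[K]_n) :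
  modulus (inner f v) ^+ 2 = modulus (\sum_i conj (f i 0) * v i 0) ^+ 2 :> R.
Proof.
rewrite -modulus_sq_conj sconj_sum; congr (modulus _ ^+ 2).
by apply: eq_bigr => i _; rewrite sconjM sconjK.
Qed.

Lemma energy_continuous (f : 'cV[K]_n) :
  continuous (fun v : 'cV[K]_n => modulus (inner f v) ^+ 2).
Proof.
under eq_fun do rewrite modulus_sq_innerE.
pose lin (v : 'cV[K]_n) : K := \sum_i conj (f i 0) * v i 0.
move=> v; apply: (@continuous_comp _ _ _ (fun v => modulus (lin v))
  (fun t : R => t ^+ 2)); last exact: exprn_continuous.
apply: (@continuous_comp _ _ _ lin (@modulus R k)); last first.
  exact: modulus_continuous.
move: v; apply: (@continuous_big K _ _ _ _ add_continuous) => i _ v.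
apply: (@continuous_comp _ _ _ (fun v : 'cV[K]_n => v i 0)
  ( *%R (conj (f i 0)))).
  exact: coord_continuous.
exact: mulrl_continuous.
Qed.

End Outer.

(** * Integrability of the entries *)
Section Polarization.
Variables (R : realType) (k : scalar_kind) (n : nat).
Local Notation K := (scalar_field R k).
Local Notation conj := (@sconj R k).

Lemma inner_pair (a s : K) (i j : 'I_n) : exists f, forall v : 'cV[K]_n,
  modulus (inner f v) ^+ 2 = modulus (a * v i 0 + s * v j 0) ^+ 2 :> R.
Proof.
exists (\col_l conj (a * (l == i)%:R + s * (l == j)%:R)) => v.
rewrite modulus_sq_innerE; congr (modulus _ ^+ 2).
have sel (b : K) p : \sum_l b * (l == p)%:R * v l 0 = b * v p 0.
  rewrite (bigD1 p)//= eqxx mulr1 big1 ?addr0// => l /negbTE ->.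
  by rewrite mulr0 mul0r.
rewrite -!sel -big_split /=; apply: eq_bigr => l _.
by rewrite mxE sconjK mulrDl.
Qed.

(** Each real or imaginary part of an entry of [v v^*] is a multiple of a
difference of two energies of [v], so that the upper frame inequality, which only speaks of
energies, bounds its integral. *)
Lemma realify_outer_polarization p : exists (c : R) (f g : 'cV[K]_n),
  forall v : 'cV[K]_n, realify (outer v) 0 p =
    c * (modulus (inner f v) ^+ 2 - modulus (inner g v) ^+ 2).
Proof.
have polar (a : K) i j : exists f g : 'cV[K]_n, forall v : 'cV[K]_n,
    sre (a * (v i 0 * conj (v j 0))) =
    4^-1 * (modulus (inner f v) ^+ 2 - modulus (inner g v) ^+ 2).
  have [f fE] := inner_pair a 1 i j; have [g gE] := inner_pair a (- 1) i j.
  exists f, g => v.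
  by rewrite fE gE mul1r mulN1r -sre_polarization mulrA.
case/mxvec_indexP: p => i j; case: (split_ordP j) => l ->.
  have [f [g fgE]] := polar 1 i l; exists 4^-1, f, g => v.
  by rewrite mxvecE row_mxEl [map_mx _ _ _ _]mxE outerE -fgE mul1r.
have [f [g fgE]] := polar (imag_unit R k) i l; exists (- 4^-1), f, g => v.
rewrite mxvecE row_mxEr [map_mx _ _ _ _]mxE outerE mulNr -fgE.
by rewrite sre_imag_unitM opprK.
Qed.

End Polarization.

Section FrameEnergy.
Variables (R : realType) (k : scalar_kind) (n : nat).
Variables (d : measure_display) (Omega : measurableType d).
Variable mu : {measure set Omega -> \bar R}.
Local Notation K := (scalar_field R k).
Variable phi : Omega -> 'cV[K]_n.
Hypothesis phi_frame : mu_frame mu phi.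

Lemma frame_energy_integrable f :
  mu.-integrable setT (fun x => (modulus (inner f (phi x)) ^+ 2)%:E).
Proof.
have [mphi [A [B [A0 [AB /(_ f)[_ fB]]]]]] := phi_frame.
apply/integrableP; split; last first.
  apply: le_lt_trans (ltry (B * sqnorm f)); apply: le_trans fB.
  rewrite le_eqVlt; apply/orP; left; apply/eqP.
  by apply: eq_integral => x _; rewrite gee0_abs// lee_fin sqr_ge0.
apply/measurable_EFinP; apply: (measurability _ (RGenOpens.measurableE R)).
move=> _ [_ [a [b ->] <-]].
rewrite -[X in _ `&` X]/(phi @^-1`
  ((fun v => modulus (inner f v) ^+ 2) @^-1` `]a, b[)).
apply: mphi => //; apply: sub_sigma_algebra.
by move/continuousP: (@energy_continuous R k n f); apply; exact: interval_open.
Qed.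

Lemma realify_outer_integrable :
  row_integrable mu setT (fun x => realify (outer (phi x))).
Proof.
move=> p; have [c [f [g fgE]]] := @realify_outer_polarization R k n p.
under [X in mu.-integrable _ X]eq_fun do rewrite fgE EFinM EFinB.
apply: integrableZl => //.
by apply: integrableB => //; exact: frame_energy_integrable.
Qed.

Lemma mu_energy_pairing f l :
  (forall v, modulus (inner f v) ^+ 2 = pairing (realify (outer v)) l) ->
  mu_energy mu phi f =
  (pairing (row_Rintegral mu setT (fun x => realify (outer (phi x)))) l)%:E.
Proof.
move=> fl.
have [ig <-] := Rintegral_pairing l measurableT realify_outer_integrable.
rewrite /Rintegral fineK; last exact: integrable_fin_num.
by apply: eq_integral => x _; rewrite fl.
Qed.

End FrameEnergy.

(** * Discretization of the frame *)
Lemma inner_scaler (R : realType) k n (a : R) (f v : 'cV[scalar_field R k]_n) :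
  modulus (inner f (of_real k a *: v)) ^+ 2 = a ^+ 2 * modulus (inner f v) ^+ 2.
Proof.
rewrite -modulus_sq_of_realM; congr (modulus _ ^+ 2).
rewrite /inner mulr_sumr; apply: eq_bigr => i _.
by rewrite mxE sconjM sconj_of_real mulrCA.
Qed.

Theorem corollary6p11 (R : realType) (k : scalar_kind)
  (d : measure_display) (Omega : measurableType d)
  (mu : {measure set Omega -> \bar R}) (n : nat)
  (phi : Omega -> 'cV[scalar_field R k]_n) (A B : R)
  (phi_frame : mu_frame mu phi)
  (phi_lower : lower_frame_bound (mu_energy mu phi) A)
  (phi_upper : upper_frame_bound (mu_energy mu phi) B) :
  exists (N : nat) (x : 'I_N -> Omega) (s : 'I_N -> R),
    (N <= \dim (lin_span [set phi y *m adjoint (phi y) | y in [set: Omega]]))%N /\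
    (forall j, 0 < s j) /\
    let v := fun j => of_real k (s j) *: phi (x j) in
    discrete_frame v /\
    lower_frame_bound (sum_energy v) A /\
    upper_frame_bound (sum_energy v) B.
Proof.
have iF := realify_outer_integrable phi_frame.
have [N0 comb] := tchakaloff measurableT iF.
have [N [x [c [_ c0 IE ind]]]] := caratheodory comb.
(* The energy is quadratic in the vector, hence the square root. *)
exists N, x, (fun j => Num.sqrt (c j)); split.
  by apply: outer_dim; exact: outer_free ind.
split=> [j|v]; first by rewrite sqrtr_gt0.
have energyE : sum_energy v = mu_energy mu phi.
  apply/funext => f; have [l lE] := modulus_sq_inner_linear f.
  rewrite (mu_energy_pairing phi_frame lE) IE pairing_suml /sum_energy.
  congr EFin; apply: eq_bigr => j _.
  by rewrite inner_scaler sqr_sqrtr ?ltW// pairingZl -lE.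
rewrite /discrete_frame energyE; split; first exact: phi_frame.2.
by split.
Qed.
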